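(* Let $n\ge 2$ and $\rho \in \mathbf{C} \setminus \{-1, 0, 1\}$, and let $K_n(\rho)=\left[\rho^{|j-k|}\right]_{j,k=1}^n$. If $\lambda$ is a repeated eigenvalue of $K_n(\rho)$, then $\lambda = -n$ and $\lambda$ is a double eigenvalue. Moreover, $\lambda = -n$ is a double eigenvalue of type 1 iff $$\rho = \xi_n \frac{T_{(n+1)/2}(t_0)}{T_{(n-1)/2}(t_0)},$$ where $t_0 \in \mathbf{C}$ is any zero of the polynomial $$q_1(n, t) = \begin{cases} \frac{U_{n-1}(t) - n}{t-1}, & n = 4, 6, 8, \dots \\ \frac{U_{n-1}(t) - n}{t^2 - 1}, & n = 5, 7, 9, \dots; \end{cases}$$ while $\lambda = -n$ is a double eigenvalue of type 2 iff $$\rho = \frac{T_{(n+1)/2}(t_0)}{T_{(n-1)/2}(t_0)},$$ where $t_0 \in \mathbf{C}$ is any zero of the polynomial $$q_2(n, t) = \begin{cases} \frac{U_{n-1}(t) + n}{t+1}, & n = 4, 6, 8, \dots \\ U_{n-1}(t) + n, & n = 3, 5, 7, \dots \end{cases}$$ The multivaluedness of $\operatorname{Arccos} t$ does not affect the two formulas for $\rho$. When $n$ is odd, $T_{(n\pm 1)/2}(t)$ is the Chebyshev polynomial of the first kind.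
   Context: Here $\xi_n = \frac{n+1}{n-1}$; $U_k(t)$ is the Chebyshev polynomial of the second kind, $U_k(t)=\frac{\sin[(k+1)\theta]}{\sin\theta}$ with $t=\cos\theta\in\mathbf{C}$; and $T_{(n\pm 1)/2}(t) = \cos\left(\frac{n\pm 1}{2} \operatorname{Arccos} t\right)$ for $t \in \mathbf{C}$. Eigenvalues of $K_n(\rho)$ (for $\rho \in \mathbf{C} \setminus \{-\xi_n,-1,0,1,\xi_n\}$) are classified as follows: writing $z=e^{i\mu}$ with $z\neq\pm1$ ($\mu$ not an integer multiple of $\pi$), a type-1 eigenvalue is $\lambda=-\frac{\sin(n\mu)}{\sin\mu}$ where $\mu$ satisfies $\sin\frac{\mu(n+1)}{2}-\rho\sin\frac{\mu(n-1)}{2}=0$ (equivalently $z$ is a zero of $s_{n+1}(\rho,z)=z^{n+1}-\rho z^n+\rho z-1$; eigenvector with entries $\sin[\mu(j-\frac{n-1}{2})]$, $j=0,\dots,n-1$, which is skew-symmetric), and a type-2 eigenvalue is $\lambda=\frac{\sin(n\mu)}{\sin\mu}$ where $\mu$ satisfies $\cos\frac{\mu(n+1)}{2}-\rho\cos\frac{\mu(n-1)}{2}=0$ (equivalently $z$ is a zero of $c_{n+1}(\rho,z)=z^{n+1}-\rho z^n-\rho z+1$; eigenvector with entries $\cos[\mu(j-\frac{n-1}{2})]$, which is symmetric). The two types are mutually exclusive; there are $\lfloor n/2\rfloor$ type-1 and $\lceil n/2\rceil$ type-2 eigenvalues. For $\rho=\pm\xi_n$, $K_n(\rho)$ has no repeated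 eigenvalues. *)

(* Defs.v *)
From HB Require Import structures.
From mathcomp Require Import all_boot all_order all_algebra.
From mathcomp Require Import reals.
From mathcomp Require Import complex.
Set Implicit Arguments. Unset Strict Implicit. Unset Printing Implicit Defensive.
Import Order.TTheory GRing.Theory Num.Theory.
Local Open Scope ring_scope.

Section Defs.
Variable C : fieldType.

Definition Kmx (n : nat) (rho : C) : 'M[C]_n :=
  \matrix_(j < n, k < n) rho ^+ (maxn j k - minn j k)%N.

Definition xi (n : nat) : C := (n.+1)%:R / (n.-1)%:R.

Fixpoint chebU_pair (k : nat) : {poly C} * {poly C} :=
  match k with
  | 0 => (1, 2%:R *: 'X)
  | k'.+1 => let: (a, b) := chebU_pair k' in (b, 2%:R *: 'X * b - a)
  end.
Definition chebU (k : nat) : {poly C} := (chebU_pair k).1.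

Definition q1 (n : nat) : {poly C} :=
  if odd n then (chebU n.-1 - (n%:R)%:P) %/ ('X^2 - 1)
  else (chebU n.-1 - (n%:R)%:P) %/ ('X - 1).
Definition q2 (n : nat) : {poly C} :=
  if odd n then chebU n.-1 + (n%:R)%:P
  else (chebU n.-1 + (n%:R)%:P) %/ ('X + 1).

(* T_{k/2}(t) = cos((k/2) Arccos t): writing Arccos t = theta and
   w = e^{i theta/2} (so w ranges over the nonzero numbers), one has
   t = cos theta = (w^2 + w^-2)/2 and T_{k/2}(t) = (w^k + w^-k)/2. *)
Definition cos_of_half (w : C) : C := (w ^+ 2 + w ^- 2) / 2%:R.
Definition chebT_half (k : nat) (w : C) : C := (w ^+ k + w ^- k) / 2%:R.

(* Type-1 eigenvalue: lambda = - sin(n mu)/sin mu with z = e^{i mu} != +-1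
   a zero of s_{n+1}(rho,z) = z^{n+1} - rho z^n + rho z - 1.
   Here sin(n mu)/sin mu = (z^n - z^-n)/(z - z^-1). *)
Definition type1_eig (n : nat) (rho lam : C) : Prop :=
  exists z : C, [/\ z != 0, z != 1, z != -1,
    z ^+ n.+1 - rho * z ^+ n + rho * z - 1 = 0 &
    lam = - ((z ^+ n - z ^- n) / (z - z^-1))].

(* Type-2 eigenvalue: lambda = sin(n mu)/sin mu with z = e^{i mu} != +-1
   a zero of c_{n+1}(rho,z) = z^{n+1} - rho z^n - rho z + 1. *)
Definition type2_eig (n : nat) (rho lam : C) : Prop :=
  exists z : C, [/\ z != 0, z != 1, z != -1,
    z ^+ n.+1 - rho * z ^+ n - rho * z + 1 = 0 &
    lam = (z ^+ n - z ^- n) / (z - z^-1)].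

Definition eigmult (n : nat) (rho lam : C) : nat := mup lam (char_poly (Kmx n rho)).

End Defs.

Arguments Kmx {C} n rho.
Arguments xi {C} n.
Arguments chebU_pair {C} k.
Arguments chebU {C} k.
Arguments q1 {C} n.
Arguments q2 {C} n.
Arguments cos_of_half {C} w.
Arguments chebT_half {C} k w.
Arguments type1_eig {C} n rho lam.
Arguments type2_eig {C} n rho lam.
Arguments eigmult {C} n rho lam.

(* Main.v *)
Require Import Defs.
From HB Require Import structures.
From mathcomp Require Import all_boot all_order all_algebra.
From mathcomp Require Import reals.
From mathcomp Require Import complex.
From mathcomp Require Import ring.
Import Order.TTheory GRing.Theory Num.Theory.
Local Open Scope ring_scope.
Local Open Scope complex_scope.

(* The substitution lambda = (1 - rho^2) z / D(z), D(z) = (1 - rho z)(z - rho)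
   (the generating function of the Toeplitz matrix), turns the three-term
   recurrence of the characteristic polynomials into one with constant
   coefficients, which gives, with l ranging over the eigenvalues,
     (1 - rho^2) (z^2 - 1) prod_l ((1 - rho^2) z - l D(z))
       = (rho (1 - rho^2))^n s_{n+1}(rho, z) c_{n+1}(rho, z).
   For l <> 0 the quadratic (1 - rho^2) z - l D(z) is proportional to
   (z - z0)(z - 1/z0).  Hence the algebraic multiplicity m of l is the order of
   z0 as a zero of s or of c (never of both) when z0 <> 1, -1, while that order
   is 2m + 1 when z0 = 1 or -1.  Looking at four consecutive Euler derivatives,
   neither s nor c has a zero of order 4, a zero of order 3 must be 1 or -1,
   and a zero z0 is multiple iff n D(z0) = - (1 - rho^2) z0, i.e. iff the
   eigenvalue is -n.  The formulas for rho follow by solving s = 0 or c = 0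
   for rho and using U_{n-1}(t0) = n or -n. *)

(** * Determinants: a three-term recurrence for the characteristic polynomials *)

Lemma char_poly_horner {F : fieldType} (n : nat) (A : 'M[F]_n) (x : F) :
  (char_poly A).[x] = \det (x%:M - A).
Proof.
rewrite -horner_evalE /char_poly -det_map_mx; congr (\det _).
by apply/matrixP=> i j; rewrite !mxE /= /horner_eval hornerD hornerN hornerC hornerMn hornerX.
Qed.

(** Laplace expansion along the first row, then along the first column of the one other minor that
    survives: the continuant step of tridiagonal determinants. *)
Lemma expand_det_corner {F : fieldType} (n : nat) (A : 'M[F]_n.+2) :
  (forall j : 'I_n, A ord0 (lift ord0 (lift ord0 j)) = 0) ->
  (forall i : 'I_n, A (lift ord0 (lift ord0 i)) ord0 = 0) ->
  \det A = A ord0 ord0 * \det (\matrix_(i, j) A (lift ord0 i) (lift ord0 j))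
    - A ord0 (lift ord0 ord0) * A (lift ord0 ord0) ord0
      * \det (\matrix_(i, j) A (lift ord0 (lift ord0 i)) (lift ord0 (lift ord0 j))).
Proof.
move=> A0j Ai0; rewrite (expand_det_row A ord0) !big_ord_recl big1 => [|j _]; last first.
  by rewrite A0j mul0r.
have minor0 : row' ord0 (col' ord0 A) = \matrix_(i, j) A (lift ord0 i) (lift ord0 j).
  by apply/matrixP=> i j; rewrite !mxE.
have lift10 : lift (lift ord0 ord0) ord0 = ord0 :> 'I_n.+2 by apply/val_inj.
have minor1 : \det (row' ord0 (col' (lift ord0 ord0) A)) =
    A (lift ord0 ord0) ord0
      * \det (\matrix_(i, j) A (lift ord0 (lift ord0 i)) (lift ord0 (lift ord0 j))).
  rewrite (expand_det_col _ ord0) big_ord_recl big1 => [|i _]; last first.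
    by rewrite !mxE lift10 Ai0 mul0r.
  rewrite /cofactor /= addn0 expr0 mul1r addr0 !mxE lift10.
  congr (_ * \det _); apply/matrixP=> i j; rewrite !mxE; congr (A _ _).
  exact/val_inj.
rewrite /cofactor minor0 minor1 /= !addn0 expr0 mul1r expr1 mulN1r addr0.
by rewrite mulrN mulrA.
Qed.

(** The off-diagonal entries of a row are successive powers of [rho], so subtracting [rho] times the
    second row from the first, and likewise for columns, clears the first row and column beyond
    their first two entries. *)
Lemma det_Kmx_rec {F : fieldType} (n : nat) (rho x : F) :
  \det (x%:M - Kmx n.+2 rho) =
    (x * (1 + rho ^+ 2) - (1 - rho ^+ 2)) * \det (x%:M - Kmx n.+1 rho)
    - (rho * x) ^+ 2 * \det (x%:M - Kmx n rho).
Proof.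
set M := x%:M - _.
pose T : 'M[F]_n.+2 := 1%:M - rho *: delta_mx ord0 (lift ord0 ord0).
have detT : \det T = 1.
  rewrite -det_tr det_trig.
    apply: big1 => i _; rewrite !mxE eqxx.
    by case: eqVneq => [->|_]; rewrite ?mulr0 ?subr0 //= mulr0 subr0.
  apply/is_trig_mxP => i j lt_ij; rewrite !mxE -!val_eqE /= gtn_eqF //.
  by case: (nat_of_ord j) lt_ij => [|j'] lt_ij; rewrite ?ltn0 // in lt_ij *; rewrite mulr0 subr0.
have -> : \det M = \det (T *m M *m T^T) by rewrite !det_mulmx det_tr detT mul1r mulr1.
have NE i j : (T *m M *m T^T) i j =
    (M i j - rho * (i == ord0)%:R * M (lift ord0 ord0) j)
    - rho * (j == ord0)%:R * (M i (lift ord0 ord0)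
        - rho * (i == ord0)%:R * M (lift ord0 ord0) (lift ord0 ord0)).
  have TM (A : 'M[F]_n.+2) k l :
      (T *m A) k l = A k l - rho * (k == ord0)%:R * A (lift ord0 ord0) l.
    rewrite mulmxBl mul1mx -scalemxAl !mxE; congr (_ - _); rewrite -mulrA; congr (_ * _).
    rewrite (bigD1 (lift ord0 ord0)) //= big1 ?addr0 => [|m /negPf nm].
      by rewrite !mxE eqxx andbT.
    by rewrite !mxE nm andbF mul0r.
  (* Right multiplication by [T^T] is left multiplication by [T] after transposing, so [TM] serves
     for rows and for columns. *)
  have -> : (T *m M *m T^T) i j = (T *m (T *m M)^T) j i.
    have -> : T *m (T *m M)^T = (T *m M *m T^T)^T by rewrite [RHS]trmx_mul trmxK.
    by rewrite [RHS]mxE.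
  by rewrite TM ![(_ *m _)^T _ _]mxE !TM.
rewrite expand_det_corner => [|j|i].
- have -> : \matrix_(i, j) (T *m M *m T^T) (lift ord0 i) (lift ord0 j)
      = x%:M - Kmx n.+1 rho.
    apply/matrixP=> i j; rewrite mxE NE !mxE /= !mulr0 !mul0r !subr0.
    by rewrite (inj_eq lift_inj) /bump /= !add1n maxnSS minnSS subSS.
  have -> : \matrix_(i, j) (T *m M *m T^T) (lift ord0 (lift ord0 i)) (lift ord0 (lift ord0 j))
      = x%:M - Kmx n rho.
    apply/matrixP=> i j; rewrite mxE NE !mxE /= !mulr0 !mul0r !subr0.
    by rewrite !(inj_eq lift_inj) /bump /= !add1n !(maxnSS, minnSS) !subSS.
  by rewrite !NE !mxE /= /bump /=; rewrite !mulr0n !mulr1n; ring.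
- rewrite NE !mxE /= /bump /= !add1n /maxn /minn /=.
  by rewrite !subSS subn0 mulr0n exprS; ring.
- rewrite NE !mxE /= /bump /= !add1n /maxn /minn /=.
  by rewrite !subSS subn0 mulr0n exprS; ring.
Qed.

(** After multiplication by [d ^+ n] the recurrence has the constant coefficients [c * (z ^+ 2 + 1)]
    and [(c * z) ^+ 2]. Its characteristic roots are [c] and [c * z ^+ 2], whose powers form the
    right-hand side, a difference of squares equal to s times c. *)
Lemma det_Kmx_symbol {F : fieldType} (n : nat) (rho x z : F) :
  x * ((1 - rho * z) * (z - rho)) = (1 - rho ^+ 2) * z ->
  (1 - rho ^+ 2) * (z ^+ 2 - 1)
    * (((1 - rho * z) * (z - rho)) ^+ n * \det (x%:M - Kmx n rho))
  = (rho * (1 - rho ^+ 2)) ^+ n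
    * (((z - rho) * z ^+ n) ^+ 2 - (1 - rho * z) ^+ 2).
Proof.
set d := _ * (z - rho) => xd; set c := rho * _.
suff [] : (1 - rho ^+ 2) * (z ^+ 2 - 1) * (d ^+ n * \det (x%:M - Kmx n rho))
      = c ^+ n * (((z - rho) * z ^+ n) ^+ 2 - (1 - rho * z) ^+ 2)
  /\ (1 - rho ^+ 2) * (z ^+ 2 - 1) * (d ^+ n.+1 * \det (x%:M - Kmx n.+1 rho))
      = c ^+ n.+1 * (((z - rho) * z ^+ n.+1) ^+ 2 - (1 - rho * z) ^+ 2) by [].
elim: n => [|n [IH0 IH1]]; split=> //.
- by rewrite det_mx00 /=; ring.
- have -> : \det (x%:M - Kmx 1 rho) = x - 1 by rewrite det_mx11 !mxE.
  transitivity ((1 - rho ^+ 2) * (z ^+ 2 - 1) * (x * d - d)); first by ring.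
  by rewrite xd /d /c; ring.
rewrite det_Kmx_rec.
have da : d * (x * (1 + rho ^+ 2) - (1 - rho ^+ 2)) = c * (z ^+ 2 + 1).
  transitivity (x * d * (1 + rho ^+ 2) - (1 - rho ^+ 2) * d); first by ring.
  by rewrite xd /d /c; ring.
have dx : d ^+ 2 * (rho * x) ^+ 2 = (c * z) ^+ 2.
  transitivity ((rho * (x * d)) ^+ 2); first by ring.
  by rewrite xd /c; ring.
transitivity ((d * (x * (1 + rho ^+ 2) - (1 - rho ^+ 2)))
    * ((1 - rho ^+ 2) * (z ^+ 2 - 1) * (d ^+ n.+1 * \det (x%:M - Kmx n.+1 rho)))
  - (d ^+ 2 * (rho * x) ^+ 2)
    * ((1 - rho ^+ 2) * (z ^+ 2 - 1) * (d ^+ n * \det (x%:M - Kmx n rho)))).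
  by rewrite !exprS; ring.
by rewrite da dx IH0 IH1 !exprS; ring.
Qed.

(** At 0 the recurrence keeps only its first term, with the nonzero factor [- (1 - rho ^+ 2)]. *)
Lemma det_Kmx_neq0 {F : fieldType} (n : nat) (rho : F) :
  rho ^+ 2 != 1 -> \det ((0 : F)%:M - Kmx n rho) != 0.
Proof.
move=> rho2; case: n => [|n]; first by rewrite det_mx00 oner_eq0.
elim: n => [|n IH].
  by rewrite det_mx11 !mxE /= mul0rn sub0r oppr_eq0 oner_eq0.
rewrite det_Kmx_rec mul0r sub0r mulr0 expr0n mul0r subr0 mulf_neq0 //.
by rewrite oppr_eq0 subr_eq0 eq_sym.
Qed.

(** * Orders of zeros and the Euler operator *)

Lemma mup_prod_XsubC {F : fieldType} (r : seq F) (x : F) :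
  mup x (\prod_(y <- r) ('X - y%:P)) = count_mem x r.
Proof.
elim: r => [|y r IH]; first by rewrite big_nil mupNroot // root1.
rewrite big_cons mupM ?polyXsubC_eq0 //; last first.
  by rewrite monic_neq0 // monic_prod // => i _; rewrite monicXsubC.
by rewrite IH /= -{1}['X - y%:P]expr1 mup_XsubCX eq_sym; case: eqP.
Qed.

Lemma mup_scale {F : fieldType} (c x : F) (p : {poly F}) :
  c != 0 -> mup x (c *: p) = mup x p.
Proof. by move=> c0; rewrite -mul_polyC mupMr // rootC. Qed.

(* Unlike d/dX, the Euler operator X d/dX acts diagonally on the four monomials
   of [symbol_poly], so multiplicity conditions become Vandermonde-like. *)
Definition euler {F : fieldType} (p : {poly F}) : {poly F} := 'X * p^`().

(** Each application of the operator costs at most one factor X - z. *)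
Lemma euler_dvdp_exp {F : fieldType} (j k : nat) (z : F) (p : {poly F}) :
  ('X - z%:P) ^+ (j + k) %| p -> ('X - z%:P) ^+ k %| iter j euler p.
Proof.
elim: j k => [|j IH] k //; rewrite addSnnS => /IH /dvdpP [q dq].
rewrite iterS dq /euler derivM deriv_exp derivXsubC mul1r /= mulrDr.
rewrite dvdp_add // !dvdp_mull // ?exprS ?dvdp_mulIr //.
by rewrite -mulr_natr dvdp_mulr.
Qed.

Lemma euler_root {F : fieldType} (j k : nat) (z : F) (p : {poly F}) :
  ('X - z%:P) ^+ k %| p -> (j < k)%N -> (iter j euler p).[z] = 0.
Proof.
move=> dv jk; apply/rootP; rewrite -dvdp_XsubCl -[_ - _]expr1 euler_dvdp_exp //.
by rewrite (dvdp_trans _ dv) // addn1 dvdp_exp2l.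
Qed.

Lemma double_root {F : fieldType} (z : F) (p : {poly F}) :
  z != 0 -> p.[z] = 0 -> (euler p).[z] = 0 -> ('X - z%:P) ^+ 2 %| p.
Proof.
move=> z0 /rootP/factor_theorem [q ->].
rewrite /euler derivM derivXsubC mulr1 !hornerE subrr mulr0 add0r.
move=> /eqP; rewrite mulf_eq0 (negPf z0) /= => /factor_theorem [s ->].
by rewrite -mulrA -expr2 dvdp_mulIr.
Qed.

(** * Multiple zeros of s and c *)

(* s_{n+1}(rho, z) for e = 1 and c_{n+1}(rho, z) for e = -1. *)
Definition symbol_poly {F : fieldType} (n : nat) (e rho : F) : {poly F} :=
  'X^(n.+1) - rho *: 'X^n + (e * rho) *: 'X - e%:P.

Lemma horner_symbol_poly {F : fieldType} (n : nat) (e rho z : F) :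
  (symbol_poly n e rho).[z] = (z - rho) * z ^+ n - e * (1 - rho * z).
Proof.
by rewrite !(hornerD, hornerN, hornerZ, hornerXn, hornerX, hornerC) exprS; ring.
Qed.

(** The monomials of degree n+1, n, 1, 0 have Euler eigenvalues n+1, n, 1, 0. The exponent starts at
    [k.+1] because the constant term disappears only with the first application. *)
Lemma euler_symbol_poly {F : fieldType} (n k : nat) (e rho z : F) :
  (iter k.+1 euler (symbol_poly n e rho)).[z]
  = (n%:R + 1) ^+ k.+1 * (z * z ^+ n) - n%:R ^+ k.+1 * (rho * z ^+ n) + e * (rho * z).
Proof.
have XdXn m : 'X * ('X^m)^`() = m%:R *: 'X^m :> {poly F}.
  rewrite derivXn mulrnAr scaler_nat; case: m => [|m]; first by rewrite !mulr0n.
  by rewrite -exprS.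
have eulerE (a b c d : F) : euler (a *: 'X^(n.+1) - b *: 'X^n + c *: 'X - d%:P)
    = ((n%:R + 1) * a) *: 'X^(n.+1) - (n%:R * b) *: 'X^n + c *: 'X - 0%:P.
  rewrite /euler derivB derivD derivB !derivZ derivX derivC !subr0 mulrDr mulrBr natr1.
  by rewrite -!scalerAr !XdXn !scalerA mulr1 ![_ * _%:R]mulrC.
have -> : iter k.+1 euler (symbol_poly n e rho) = (n%:R + 1) ^+ k.+1 *: 'X^(n.+1)
    - (n%:R ^+ k.+1 * rho) *: 'X^n + (e * rho) *: 'X - 0%:P.
  elim: k => [|k IH].
    have -> : symbol_poly n e rho = 1 *: 'X^(n.+1) - rho *: 'X^n + (e * rho) *: 'X - e%:P.
      by rewrite scale1r.
    by rewrite /= eulerE mulr1 !expr1.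
  by rewrite iterS IH eulerE mulrA -!exprS.
by rewrite !(hornerD, hornerN, hornerZ, hornerXn, hornerX, hornerC) [z ^+ n.+1]exprS; ring.
Qed.

Lemma symbol_poly_root_neq0 {F : fieldType} (n : nat) (e rho z : F) :
  e != 0 -> (0 < n)%N -> (symbol_poly n e rho).[z] = 0 -> z != 0.
Proof.
move=> e0 n0; rewrite horner_symbol_poly; apply: contra_eq_neq => ->.
by rewrite expr0n -[n == 0]negbK -lt0n n0 !mulr0 sub0r subr0 mulr1 oppr_eq0.
Qed.

(** Eliminating the top monomial from the first two Euler derivatives gives [z ^+ n = e * z], and
    then the polynomial takes the value [e * (z ^+ 2 - 1)] at [z]. *)
Lemma symbol_poly_triple {C : numFieldType} (n : nat) (e rho z : C) :
  e != 0 -> rho != 0 -> (0 < n)%N ->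
  ('X - z%:P) ^+ 3 %| symbol_poly n e rho -> z ^+ 2 = 1.
Proof.
move=> e0 rho0 n0 dv3.
have N0 : n%:R != 0 :> C by rewrite pnatr_eq0 -lt0n.
have h0 := euler_root 0 _ _ _ dv3 isT.
have h1 := euler_root 1 _ _ _ dv3 isT; have h2 := euler_root 2 _ _ _ dv3 isT.
rewrite horner_symbol_poly in h0; rewrite euler_symbol_poly expr1 in h1.
rewrite euler_symbol_poly in h2.
have /(mulfI N0) Er : n%:R * (e * (rho * z)) = n%:R * (rho * z ^+ n).
  apply/eqP; rewrite -subr_eq0.
  rewrite -[X in _ == X]subr0 -[X in _ == _ - X]h2 -[X in _ == X - _](mulr0 (n%:R + 1)) -h1.
  by apply/eqP; ring.
have zn : z ^+ n = e * z by apply: (mulfI rho0); rewrite -Er; ring.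
apply: (mulfI e0); apply/eqP; rewrite -subr_eq0 -h0 zn; apply/eqP; ring.
Qed.

(** With E the Euler operator, E(E-1)(E-n) kills every monomial but the top one. The combination
    [h3 - (n+1) h2 + n h1] therefore leaves n(n+1) z^(n+1), which is nonzero. *)
Lemma symbol_poly_quadruple {C : numFieldType} (n : nat) (e rho z : C) :
  e != 0 -> (0 < n)%N -> ~~ (('X - z%:P) ^+ 4 %| symbol_poly n e rho).
Proof.
move=> e0 n0; apply/negP=> dv4.
have N0 : n%:R != 0 :> C by rewrite pnatr_eq0 -lt0n.
have N1 : n%:R + 1 != 0 :> C by rewrite natr1 pnatr_eq0.
have z0 := symbol_poly_root_neq0 _ _ _ _ e0 n0 (euler_root 0 _ _ _ dv4 isT).
have h1 := euler_root 1 _ _ _ dv4 isT; have h2 := euler_root 2 _ _ _ dv4 isT.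
have h3 := euler_root 3 _ _ _ dv4 isT.
rewrite !euler_symbol_poly expr1 in h1 h2 h3.
have /eqP : (n%:R + 1) * n%:R * (z * z ^+ n) = 0.
  transitivity (0 - (n%:R + 1) * 0 + n%:R * 0 : C); last by rewrite !mulr0 subrr addr0.
  by rewrite -{1}h3 -{1}h2 -h1; ring.
by rewrite !mulf_eq0 (negPf N0) (negPf N1) expf_eq0 (negPf z0) andbF.
Qed.

(** * The product identity and the count of eigenvalues *)

(* [lam * (1 - rho z) (z - rho) = (1 - rho^2) z] says that [lam] is the value
   at [z] of the generating function of the Toeplitz matrix. *)
Definition symbol_level {F : fieldType} (rho lam : F) : {poly F} :=
  (1 - rho ^+ 2) *: 'X - lam *: ((1 - rho *: 'X) * ('X - rho%:P)).

Lemma horner_symbol_level {F : fieldType} (rho lam z : F) :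
  (symbol_level rho lam).[z] = (1 - rho ^+ 2) * z - lam * ((1 - rho * z) * (z - rho)).
Proof. by rewrite !(hornerM, hornerD, hornerN, hornerZ, hornerXn, hornerX, hornerC). Qed.

Lemma char_poly_Kmx_split {C : numClosedFieldType} (n : nat) (rho : C) :
  {r : seq C | char_poly (Kmx n rho) = \prod_(l <- r) ('X - l%:P) & size r = n}.
Proof.
have [r Er] := closed_field_poly_normal (char_poly (Kmx n rho)).
have {}Er : char_poly (Kmx n rho) = \prod_(l <- r) ('X - l%:P).
  by rewrite {1}Er (monicP (char_poly_monic _)) scale1r.
exists r => //; have := size_char_poly (Kmx n rho).
by rewrite Er size_prod_XsubC => -[].
Qed.

(** The determinant formula gives the identity only where D(z) is nonzero. Hence [D * P] vanishes at
    every point, so it is the zero polynomial, and [D] cancels. *)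
Lemma prod_symbol_level {C : numClosedFieldType} (n : nat) (rho : C) (r : seq C) :
  rho != 0 -> char_poly (Kmx n rho) = \prod_(l <- r) ('X - l%:P) -> size r = n ->
  (1 - rho ^+ 2) *: (('X^2 - 1) * \prod_(l <- r) symbol_level rho l)
  = (rho * (1 - rho ^+ 2)) ^+ n *: (symbol_poly n 1 rho * symbol_poly n (-1) rho).
Proof.
move=> rho0 Er sr; apply/eqP; rewrite -subr_eq0; set P := _ - _.
pose D : {poly C} := (1 - rho *: 'X) * ('X - rho%:P).
have D0 : D != 0.
  apply/eqP=> /(congr1 (fun p => p.[0])); rewrite hornerM !hornerE /= => /eqP.
  by rewrite ?(mulr0, subr0, mul1r, sub0r, oppr_eq0) (negPf rho0).
have : D * P == 0; last by rewrite mulf_eq0 (negPf D0).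
apply: contraTT isT => /closed_nonrootP [z]; rewrite /root hornerM.
set d := D.[z]; have [->|d0] := eqVneq d 0; first by rewrite mul0r eqxx.
have dE : d = (1 - rho * z) * (z - rho).
  by rewrite /d /D !(hornerM, hornerD, hornerN, hornerZ, hornerXn, hornerX, hornerC).
suff -> : P.[z] = 0 by rewrite mulr0 eqxx.
pose x := (1 - rho ^+ 2) * z / d.
have xd : x * d = (1 - rho ^+ 2) * z by rewrite divfK.
have := det_Kmx_symbol n rho x z; rewrite -dE => /(_ xd).
rewrite -char_poly_horner Er horner_prod => id_x.
apply/eqP; rewrite /P hornerD hornerN subr_eq0 !hornerZ !hornerM !horner_symbol_poly horner_prod.
rewrite hornerD hornerN hornerXn hornerC.
have -> : \prod_(l <- r) (symbol_level rho l).[z] = d ^+ n * \prod_(l <- r) ('X - l%:P).[x].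
  rewrite -sr; elim: (r) => [|l s IH]; first by rewrite !big_nil mul1r.
  rewrite !big_cons IH horner_symbol_level -dE -xd hornerXsubC /= exprS; ring.
by rewrite mulrA id_x; apply/eqP; ring.
Qed.

Lemma mup_prod {F : fieldType} (I : Type) (r : seq I) (G : I -> {poly F}) (x : F) :
  (forall i, G i != 0) -> mup x (\prod_(i <- r) G i) = \sum_(i <- r) mup x (G i).
Proof.
move=> G0; elim: r => [|i r IH]; first by rewrite !big_nil mupNroot // root1.
rewrite !big_cons mupM ?IH //.
by elim/big_ind: _ => // [|p q]; [apply: oner_neq0 | apply: mulf_neq0].
Qed.

Lemma symbol_level_neq0 {F : fieldType} (rho lam : F) :
  rho != 0 -> rho ^+ 2 != 1 -> symbol_level rho lam != 0.
Proof.
move=> rho0 rho2; apply/eqP=> E.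
have /eqP := congr1 (fun p => p.[rho]) E.
rewrite horner_symbol_level subrr !mulr0 subr0 horner0 mulf_eq0 (negPf rho0) orbF.
by rewrite subr_eq0 eq_sym (negPf rho2).
Qed.

(** A zero of D at [z] would force (1 - rho^2) z = 0, so D(z) can be cancelled. *)
Lemma symbol_level_inj {F : fieldType} (rho lam mu z : F) :
  rho ^+ 2 != 1 -> z != 0 -> (symbol_level rho lam).[z] = 0 ->
  (symbol_level rho mu).[z] = 0 -> lam = mu.
Proof.
move=> rho2 z0; rewrite !horner_symbol_level; set d := (1 - _ * z) * _.
move=> /eqP; rewrite subr_eq0 => /eqP E /eqP; rewrite subr_eq0 E => /eqP.
apply: mulIf; apply: contra_neq rho2 => d0.
by move/eqP: E; rewrite d0 mulr0 mulf_eq0 (negPf z0) orbF subr_eq0 => /eqP.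
Qed.

(** The quadratic is palindromic, so its zeros are [z] and [z^-1], which coincide exactly when
    [z ^+ 2 = 1]. *)
Lemma mup_symbol_level_root {F : fieldType} (rho lam z : F) :
  rho != 0 -> lam != 0 -> z != 0 -> (symbol_level rho lam).[z] = 0 ->
  mup z (symbol_level rho lam) = (z ^+ 2 == 1).+1.
Proof.
move=> rho0 lam0 z0 Lz.
have cz : (1 - rho ^+ 2 - lam * (1 + rho ^+ 2)) = - (lam * rho) * (z + z^-1).
  apply: (mulIf z0); rewrite horner_symbol_level in Lz.
  rewrite -[RHS]mulrA [(z + _) * z]mulrDl mulVf //.
  by apply/eqP; rewrite -subr_eq0 -[X in _ == X]Lz; apply/eqP; ring.
have -> : symbol_level rho lam = (lam * rho) *: (('X - z%:P) * ('X - z^-1%:P)).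
  have -> : symbol_level rho lam =
      (lam * rho)%:P * 'X ^+ 2 + (1 - rho ^+ 2 - lam * (1 + rho ^+ 2))%:P * 'X + (lam * rho)%:P.
    rewrite /symbol_level -!mul_polyC !(rmorphB, rmorphD, rmorphM, rmorphXn) /=; ring.
  rewrite cz -mul_polyC !(rmorphN, rmorphD, rmorphM) /=.
  have -> : ('X - z%:P) * ('X - z^-1%:P) = 'X ^+ 2 - (z%:P + z^-1%:P) * 'X + (z * z^-1)%:P.
    by rewrite rmorphM /=; ring.
  by rewrite mulfV //; ring.
rewrite mup_scale ?mulf_neq0 // mupM ?polyXsubC_eq0 // -[X in mup z X]expr1 mup_XsubCX eqxx.
by rewrite -['X - z^-1%:P]expr1 mup_XsubCX add1n eq_sym -(inj_eq (mulfI z0)) mulfV.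
Qed.

Lemma symbol_level_root {C : numClosedFieldType} (rho lam : C) :
  rho != 0 -> lam != 0 -> exists2 z, z != 0 & (symbol_level rho lam).[z] = 0.
Proof.
move=> rho0 lam0.
(* The quadratic is a X^2 + b X + a. The quadratic formula gives [z], and the constant term excludes
   0. *)
pose a := lam * rho; pose b := 1 - rho ^+ 2 - lam * (1 + rho ^+ 2).
have a0 : a != 0 by rewrite mulf_neq0.
pose z := (sqrtC (b ^+ 2 - 4%:R * a ^+ 2) - b) / (2%:R * a).
have Lz : (symbol_level rho lam).[z] = 0.
  have zz : 2%:R * a * z = sqrtC (b ^+ 2 - 4%:R * a ^+ 2) - b.
    by rewrite mulrC divfK // mulf_neq0 // pnatr_eq0.
  have /mulfI : 4%:R * a != 0 by rewrite mulf_neq0 // pnatr_eq0.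
  apply; rewrite mulr0 horner_symbol_level.
  transitivity ((2%:R * a * z + b) ^+ 2 - (b ^+ 2 - 4%:R * a ^+ 2)); first by rewrite /a /b; ring.
  by rewrite zz subrK sqrtCK subrr.
exists z => //; apply/negP=> /eqP z0; move: Lz; rewrite z0 horner_symbol_level => /eqP.
by rewrite !mulr0 !sub0r subr0 mul1r mulrN opprK mulf_eq0 (negPf rho0) (negPf lam0).
Qed.

Lemma sqr_neq1 {F : fieldType} (z : F) : z != 1 -> z != -1 -> z ^+ 2 != 1.
Proof. by move=> z1 zN1; rewrite sqrf_eq1 negb_or z1. Qed.

Lemma mup_X2sub1 {C : numFieldType} (z : C) : mup z ('X^2 - 1) = (z ^+ 2 == 1) :> nat.
Proof.
have -> : 'X^2 - 1 = ('X - 1%:P) ^+ 1 * ('X - (-1)%:P) ^+ 1 :> {poly C}.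
  by rewrite !expr1 rmorphN rmorph1; ring.
rewrite mupM ?expf_neq0 ?polyXsubC_eq0 // !mup_XsubCX sqrf_eq1.
rewrite ![_ == z]eq_sym; case: (eqVneq z 1) => [->|z1]; last by case: eqP.
by rewrite -[1 == -1]subr_eq0 opprK -[1 + 1]/(2%:R) pnatr_eq0.
Qed.

(** Subtracting the two equations gives [rho * z = 1]; what remains forces [z = rho], hence
    [rho ^+ 2 = 1]. *)
Lemma symbol_poly_coprime {F : fieldType} (n : nat) (rho z : F) :
  rho ^+ 2 != 1 -> 2%:R != 0 :> F -> z != 0 ->
  (symbol_poly n 1 rho).[z] = 0 -> (symbol_poly n (-1) rho).[z] != 0.
Proof.
move=> rho2 two0 z0 h1; apply: contra_neq rho2 => h2.
rewrite !horner_symbol_poly in h1 h2.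
have rz : rho * z = 1.
  apply: (mulfI two0); apply/eqP; rewrite -subr_eq0.
  by rewrite -[X in _ == X]subr0 -{1}h1 -h2; apply/eqP; ring.
move: h1; rewrite rz subrr mulr0 subr0 => /eqP.
rewrite mulf_eq0 subr_eq0 expf_eq0 (negPf z0) andbF orbF => /eqP zr.
by rewrite -rz zr.
Qed.

Lemma symbol_poly_neq0 {F : fieldType} (n : nat) (e rho : F) :
  e != 0 -> symbol_poly n.+1 e rho != 0.
Proof.
move=> e0; apply: contra_neq e0 => /(congr1 (fun p => p.[0])).
rewrite horner_symbol_poly horner0 exprS !(mul0r, mulr0) subr0 mulr1 sub0r.
by move/eqP; rewrite oppr_eq0 => /eqP.
Qed.

(** Compares orders at [z] in the product identity. The first summand comes from X^2 - 1; each copy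
    of [lam] contributes 1, or 2 when [z] is its own inverse, and the other eigenvalues contribute
    nothing. *)
Lemma eigmult_symbol_poly {C : numClosedFieldType} (n : nat) (rho lam z : C) :
  rho != 0 -> rho ^+ 2 != 1 -> z != 0 -> (symbol_level rho lam).[z] = 0 ->
  ((z ^+ 2 == 1)%R + eigmult n.+1 rho lam * (z ^+ 2 == 1)%R.+1
   = mup z (symbol_poly n.+1 1 rho) + mup z (symbol_poly n.+1 (-1) rho))%N.
Proof.
move=> rho0 rho2 z0 Lz.
have lam0 : lam != 0.
  apply: contra_eq_neq Lz => ->.
  by rewrite horner_symbol_level mul0r subr0 mulf_neq0 // subr_eq0 eq_sym.
have [r Er sr] := char_poly_Kmx_split n.+1 rho.
have /(congr1 (mup z)) := prod_symbol_level _ _ _ rho0 Er sr.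
have r1 : 1 - rho ^+ 2 != 0 by rewrite subr_eq0 eq_sym.
have L0 l : symbol_level rho l != 0 by apply: symbol_level_neq0.
rewrite !mup_scale ?expf_neq0 ?mulf_neq0 // !mupM ?symbol_poly_neq0 ?oppr_eq0 ?oner_neq0 //.
- rewrite mup_X2sub1 mup_prod // => <-; congr addn.
  rewrite /eigmult Er mup_prod_XsubC -(mup_symbol_level_root _ _ _ rho0 lam0 z0 Lz).
  elim: r {Er sr} => [|l s IH]; first by rewrite big_nil.
  rewrite big_cons /= mulnDl IH; congr addn.
  case: eqVneq => [->|ll]; first by rewrite mul1n.
  rewrite mul0n mupNroot //; apply: contra ll => /rootP Ll.
  by rewrite (symbol_level_inj _ _ _ _ rho2 z0 Ll Lz).
- by rewrite -size_poly_gt0 size_XnsubC.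
- by elim/big_ind: _ => // [|p q]; [apply: oner_neq0 | apply: mulf_neq0].
Qed.

Lemma symbol_poly_mup {C : numFieldType} (n : nat) (rho z : C) :
  rho ^+ 2 != 1 -> z != 0 -> exists2 e : C, e ^+ 2 = 1 &
   (mup z (symbol_poly n.+1 1 rho) + mup z (symbol_poly n.+1 (-1) rho)
    = mup z (symbol_poly n.+1 e rho))%N.
Proof.
move=> rho2 z0; have [/rootP h|h] := boolP (root (symbol_poly n.+1 1 rho) z).
  exists 1; first by rewrite expr1n.
  rewrite [X in (_ + X)%N]mupNroot ?addn0 //.
  by apply: symbol_poly_coprime; rewrite // pnatr_eq0.
by exists (-1); rewrite ?sqrrN ?expr1n // mupNroot.
Qed.

(** * Repeated eigenvalues and the value -n *)

(** The source of the value -n: replacing [(z - rho) * z ^+ n] by [e * (1 - rho * z)] turns the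
    first Euler derivative into the level polynomial of -n. *)
Lemma euler_symbol_level {F : fieldType} (n : nat) (e rho z : F) :
  (symbol_poly n e rho).[z] = 0 ->
  (z - rho) * (euler (symbol_poly n e rho)).[z] = e * (symbol_level rho (- n%:R)).[z].
Proof.
rewrite horner_symbol_poly => /eqP; rewrite subr_eq0 => /eqP h.
rewrite (euler_symbol_poly n 0) horner_symbol_level !expr1.
transitivity (((n%:R + 1) * z - n%:R * rho) * ((z - rho) * z ^+ n) + e * rho * z * (z - rho)).
  ring.
rewrite h; ring.
Qed.

Lemma eigmult_gt1 {C : numClosedFieldType} (n : nat) (rho lam : C) :
  rho != 0 -> rho ^+ 2 != 1 -> (1 < eigmult n.+1 rho lam)%N ->
  lam = - n.+1%:R /\ eigmult n.+1 rho lam = 2%N.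
Proof.
move=> rho0 rho2 m1.
have lam0 : lam != 0.
  apply: contraTneq m1 => ->; rewrite /eigmult mupNroot //.
  by rewrite /root char_poly_horner det_Kmx_neq0.
have [z z0 Lz] := symbol_level_root _ _ rho0 lam0.
have := eigmult_symbol_poly n _ _ _ rho0 rho2 z0 Lz.
have [e e2 ->] := symbol_poly_mup n _ _ rho2 z0.
have e0 : e != 0 by apply: contra_eq_neq e2 => ->; rewrite expr0n eq_sym oner_eq0.
have S0 := symbol_poly_neq0 n e rho e0.
have := symbol_poly_quadruple n.+1 e rho z e0 isT; rewrite -mup_ltn // => m4.
(* At 1 or -1 an eigenvalue of multiplicity m >= 2 would give a zero of order 2m + 1 >= 5, against
   the bound 3. *)
case: (eqVneq (z ^+ 2) 1) => [_|z2] /= Em.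
  by move: m4; rewrite -Em; case: (eigmult _ _ _) m1 => [|[|m]] //; rewrite muln2.
rewrite add0n muln1 in Em.
have : ~~ (('X - z%:P) ^+ 3 %| symbol_poly n.+1 e rho).
  by apply: contra_neqN z2; apply: symbol_poly_triple.
rewrite -mup_ltn // -Em ltnS => m2; split; last by apply/eqP; rewrite eqn_leq m1 m2.
(* A double zero kills the first Euler derivative, so [z] also lies on the level of [- n.+1%:R],
   which identifies [lam]. *)
have dv : ('X - z%:P) ^+ 2 %| symbol_poly n.+1 e rho by rewrite -mup_geq // -Em.
apply: (symbol_level_inj _ _ _ _ rho2 z0 Lz); apply: (mulfI e0).
rewrite -euler_symbol_level; last exact: (euler_root 0 _ _ _ dv).
by rewrite (euler_root 1 _ _ _ dv) // !mulr0.
Qed.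

(** Connects the sine quotients of the two types with levels: once z - 1/z is cleared, the equation
    for [z] eliminates both [z ^+ n] and [z ^- n]. *)
Lemma symbol_level_type {F : fieldType} (n : nat) (e rho z : F) :
  e ^+ 2 = 1 -> z != 0 -> z ^+ 2 != 1 ->
  (symbol_poly n e rho).[z] = 0 ->
  (symbol_level rho (- e * ((z ^+ n - z ^- n) / (z - z^-1)))).[z] = 0.
Proof.
move=> e2 z0 z2; rewrite horner_symbol_poly => /eqP; rewrite subr_eq0 => /eqP h.
have y0 : z ^+ n != 0 by rewrite expf_neq0.
have w0 : z - z^-1 != 0.
  by rewrite -(inj_eq (mulIf z0)) mulrBl mulVf // mul0r subr_eq0.
rewrite horner_symbol_level; apply: (mulIf w0); rewrite mul0r.
transitivity ((1 - rho ^+ 2) * (z * z - z^-1 * z)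
  + e * (1 - rho * z) * ((z - rho) * z ^+ n) - (z - rho) * z ^- n * (e * (1 - rho * z))).
  by field; rewrite y0 z0 subr_eq0 -expr2.
have -> : (z - rho) * z ^- n * (e * (1 - rho * z)) = (z - rho) ^+ 2.
  transitivity ((z - rho) ^+ 2 * (z ^+ n * z ^- n)); first by rewrite -h; ring.
  by rewrite mulfV // mulr1.
rewrite h mulVf //.
transitivity ((1 - rho ^+ 2) * (z * z - 1) + e ^+ 2 * (1 - rho * z) ^+ 2 - (z - rho) ^+ 2).
  by ring.
by rewrite e2; ring.
Qed.

(** Here [z] lies on the level of -n, so the Euler derivative vanishes too and the zero is at least
    double; [eigmult_gt1] then gives multiplicity exactly 2. *)
Lemma eigmult_type {C : numClosedFieldType} (n : nat) (e rho z : C) :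
  rho != 0 -> rho ^+ 2 != 1 -> e ^+ 2 = 1 -> z != 0 -> z ^+ 2 != 1 ->
  (symbol_poly n.+1 e rho).[z] = 0 ->
  - e * ((z ^+ n.+1 - z ^- n.+1) / (z - z^-1)) = - n.+1%:R ->
  eigmult n.+1 rho (- n.+1%:R) = 2%N.
Proof.
move=> rho0 rho2 e2 z0 z2 Sz lamE.
have Lz := symbol_level_type n.+1 _ _ _ e2 z0 z2 Sz; rewrite lamE in Lz.
have [_ //] : - n.+1%:R = - n.+1%:R :> C /\ eigmult n.+1 rho (- n.+1%:R) = 2%N.
apply: eigmult_gt1 => //.
have := eigmult_symbol_poly n _ _ _ rho0 rho2 z0 Lz; rewrite (negPf z2) add0n muln1 => ->.
have e0 : e != 0 by apply: contra_eq_neq e2 => ->; rewrite expr0n eq_sym oner_eq0.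
suff m2 : (1 < mup z (symbol_poly n.+1 e rho))%N.
  move/eqP: e2; rewrite sqrf_eq1 => /orP [] /eqP e1; rewrite e1 in m2.
    exact: leq_trans m2 (leq_addr _ _).
  exact: leq_trans m2 (leq_addl _ _).
rewrite mup_geq ?symbol_poly_neq0 //; apply: double_root => //.
have zr : z - rho != 0.
  apply: contra_neq rho2 => /eqP; rewrite subr_eq0 => /eqP zr.
  move/eqP: Sz; rewrite horner_symbol_poly zr subrr mul0r sub0r oppr_eq0.
  by rewrite mulf_eq0 (negPf e0) subr_eq0 => /eqP.
by apply: (mulfI zr); rewrite euler_symbol_level // Lz !mulr0.
Qed.

(** * Chebyshev polynomials of the second kind *)

Lemma chebU_rec {F : fieldType} (k : nat) :
  chebU k.+2 = 2%:R *: 'X * chebU k.+1 - chebU k :> {poly F}.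
Proof. by rewrite /chebU /=; case: (chebU_pair k). Qed.

Lemma horner_chebU_rec {F : fieldType} (k : nat) (t : F) :
  (chebU k.+2).[t] = 2%:R * t * (chebU k.+1).[t] - (chebU k).[t].
Proof. by rewrite chebU_rec hornerD hornerN hornerM hornerZ hornerX. Qed.

(** With z = e^(i theta) this is U_k(cos theta) sin theta = sin((k+1) theta). *)
Lemma chebU_joukowski {F : fieldType} (k : nat) (z t : F) :
  2%:R != 0 :> F -> z != 0 -> t = (z + z^-1) / 2%:R ->
  (chebU k).[t] * (z - z^-1) = z ^+ k.+1 - z ^- k.+1.
Proof.
move=> two0 z0 tE; have t2 : 2%:R * t = z + z^-1 by rewrite tE mulrC divfK.
suff [] : (chebU k).[t] * (z - z^-1) = z ^+ k.+1 - z ^- k.+1 /\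
  (chebU k.+1).[t] * (z - z^-1) = z ^+ k.+2 - z ^- k.+2 by [].
elim: k => [|k [IH0 IH1]]; split=> //.
- by rewrite /chebU /= hornerC mul1r !expr1.
- by rewrite /chebU /= hornerZ hornerX t2 expr2; field.
rewrite horner_chebU_rec t2 mulrBl IH0 -mulrA IH1 !exprS.
by field; rewrite z0 expf_neq0.
Qed.

Lemma chebU_sign {F : fieldType} (k : nat) (e : F) :
  e ^+ 2 = 1 -> (chebU k).[e] = e ^+ k * k.+1%:R.
Proof.
move=> e2; suff [] : (chebU k).[e] = e ^+ k * k.+1%:R /\
  (chebU k.+1).[e] = e ^+ k.+1 * k.+2%:R by [].
elim: k => [|k [IH0 IH1]]; split=> //.
- by rewrite /chebU /= hornerC mulr1.
- by rewrite /chebU /= hornerZ hornerX mulrC expr1.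
rewrite horner_chebU_rec IH0 IH1.
have ek : e ^+ k = e ^+ k.+2 by rewrite -[k.+2]addn2 exprD e2 mulr1.
by rewrite [in X in _ - X]ek !exprS -!natr1; ring.
Qed.

(** Shows that 1 and -1 can only be simple zeros of the numerators of [q1] and [q2]. The factor 3
    keeps the formula integral. *)
Lemma deriv_chebU_sign {F : fieldType} (k : nat) (e : F) :
  e ^+ 2 = 1 -> 3%:R * (chebU k)^`().[e] = e ^+ k.+1 * (k * k.+1 * k.+2)%:R.
Proof.
move=> e2; suff [] : 3%:R * (chebU k)^`().[e] = e ^+ k.+1 * (k * k.+1 * k.+2)%:R /\
  3%:R * (chebU k.+1)^`().[e] = e ^+ k.+2 * (k.+1 * k.+2 * k.+3)%:R by [].
elim: k => [|k [IH0 IH1]]; split=> //.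
- by rewrite /chebU /= derivC horner0 mulr0 !mul0n mulr0.
- by rewrite /chebU /= derivZ derivX hornerZ hornerC mulr1 e2 mul1r -natrM.
have -> : (chebU k.+2)^`().[e] = 2%:R * (chebU k.+1).[e] + 2%:R * e * (chebU k.+1)^`().[e]
    - (chebU k)^`().[e].
  rewrite chebU_rec derivB derivM derivZ derivX.
  by rewrite !(hornerD, hornerN, hornerM, hornerZ, hornerX, hornerC) mulr1.
rewrite mulrBr IH0 mulrDr [3%:R * (_ * e * _)]mulrCA IH1 chebU_sign //.
have ek : e ^+ k.+1 = e ^+ k.+3 by rewrite -[k.+3]addn2 exprD e2 mulr1.
by rewrite ek [e ^+ k.+3]exprS !natrM -!natr1; ring.
Qed.

(** * The zeros of q1 and q2 *)

Lemma root_divp {F : fieldType} (f g : {poly F}) (t : F) :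
  g %| f -> (root g t -> f^`().[t] != 0) ->
  root (f %/ g) t <-> ~~ root g t /\ root f t.
Proof.
move=> gf f't; have fE := divpK gf; split=> [qt|[gt]]; last first.
  by rewrite -{1}fE rootM (negPf gt) orbF.
split; last by rewrite -{1}fE rootM qt.
apply/negP=> gt; have := f't gt; rewrite -{1}fE derivM hornerD !hornerM.
by rewrite (rootP qt) (rootP gt) mulr0 mul0r addr0 eqxx.
Qed.

Section ChebyshevQuotients.
Context {C : numFieldType}.
Implicit Types (t e c : C) (m : nat).

Lemma deriv_chebU_sign_neq0 m e c :
  e ^+ 2 = 1 -> (chebU m.+1 + c%:P)^`().[e] != 0.
Proof.
move=> e2; rewrite derivD derivC addr0.
have e0 : e != 0 by apply: contra_eq_neq e2 => ->; rewrite expr0n eq_sym oner_eq0.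
have : 3%:R * (chebU m.+1)^`().[e] != 0.
  by rewrite deriv_chebU_sign // mulf_neq0 ?expf_neq0 // pnatr_eq0.
by apply: contra_neq => ->; rewrite mulr0.
Qed.

Lemma natr_neq_opp m : m.+1%:R != - m.+1%:R :> C.
Proof. by rewrite -subr_eq0 opprK -natrD pnatr_eq0. Qed.

(** Since U_{n-1}(1) = n and U_{n-1}(-1) = (-1)^(n-1) n, the numerator vanishes at 1, and at -1 for
    odd n only. These zeros are simple, so the division removes exactly them. *)
Lemma root_q1 m t :
  root (q1 m.+2) t <-> t ^+ 2 != 1 /\ (chebU m.+1).[t] = m.+2%:R.
Proof.
have rootf : root (chebU m.+1 - m.+2%:R%:P) t = ((chebU m.+1).[t] == m.+2%:R).
  by rewrite /root hornerD hornerN hornerC subr_eq0.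
have U1 e : e ^+ 2 = 1 -> (chebU m.+1).[e] = e ^+ m.+1 * m.+2%:R by apply: chebU_sign.
rewrite /q1 /=; case: ifP; rewrite negbK => om.
- have rootg : root ('X^2 - 1) t = (t ^+ 2 == 1).
    by rewrite /root hornerD hornerN hornerXn hornerC subr_eq0.
  rewrite root_divp.
  + by rewrite rootf rootg; split=> -[? /eqP].
  + have -> : 'X^2 - 1 = ('X - 1%:P) * ('X - (-1)%:P) :> {poly C}.
      by rewrite rmorphN rmorph1; ring.
    rewrite Gauss_dvdp; last first.
      by rewrite coprimep_sym coprimep_XsubC root_XsubC (natr_neq_opp 0).
    rewrite !dvdp_XsubCl /root !hornerD !hornerN !hornerC !U1 ?sqrrN ?expr1n //.
    by rewrite -signr_odd /= om /= mul1r subrr eqxx.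
  + by rewrite rootg => /eqP; rewrite -polyCN; apply: deriv_chebU_sign_neq0.
- have rootg : root ('X - 1) t = (t == 1) by rewrite -[1]/(1%:P) root_XsubC.
  rewrite root_divp.
  + rewrite rootf rootg sqrf_eq1 negb_or.
    split=> [[t1 /eqP Ut]|[/andP [t1 _] ->]]; last by rewrite t1 eqxx.
    rewrite t1 Ut; split=> //; apply: contra_eq_neq Ut => ->.
    rewrite U1 ?sqrrN ?expr1n // -signr_odd /= om /= expr1 mulN1r eq_sym.
    exact: natr_neq_opp.
  + rewrite -[1]/(1%:P) dvdp_XsubCl /root hornerD hornerN hornerC U1 ?expr1n //.
    by rewrite mul1r subrr.
  + by rewrite rootg -polyCN => /eqP ->; rewrite deriv_chebU_sign_neq0 ?expr1n.
Qed.

(** For odd n the numerator is 2n at both 1 and -1; for even n it vanishes simply at -1 and is 2n at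
    1. *)
Lemma root_q2 m t :
  root (q2 m.+2) t <-> t ^+ 2 != 1 /\ (chebU m.+1).[t] = - m.+2%:R.
Proof.
have rootf : root (chebU m.+1 + m.+2%:R%:P) t = ((chebU m.+1).[t] == - m.+2%:R).
  by rewrite /root hornerD hornerC addr_eq0.
have U1 e : e ^+ 2 = 1 -> (chebU m.+1).[e] = e ^+ m.+1 * m.+2%:R by apply: chebU_sign.
rewrite /q2 /=; case: ifP; rewrite negbK => om.
- rewrite rootf; split=> [/eqP Ut|[_ /eqP //]]; split=> //.
  apply: contra_eq_neq Ut => t2.
  have tm : t ^+ m.+1 = 1.
    by rewrite -[m.+1]odd_double_half /= om add0n -mul2n exprM t2 expr1n.
  by rewrite U1 // tm mul1r natr_neq_opp.
- have rootg : root ('X + 1) t = (t == -1).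
    by rewrite /root hornerD hornerX hornerC addr_eq0.
  rewrite root_divp.
  + rewrite rootf rootg sqrf_eq1 negb_or.
    split=> [[t1 /eqP Ut]|[/andP [_ t1] ->]]; last by rewrite t1 eqxx.
    rewrite t1 Ut andbT; split=> //; apply: contra_eq_neq Ut => ->.
    by rewrite U1 ?expr1n // mul1r natr_neq_opp.
  + have -> : 'X + 1 = 'X - (-1)%:P :> {poly C} by rewrite polyCN opprK.
    rewrite dvdp_XsubCl /root hornerD hornerC U1 ?sqrrN ?expr1n //.
    by rewrite -signr_odd /= om /= expr1 mulN1r addrC subrr.
  + by rewrite rootg => /eqP ->; rewrite deriv_chebU_sign_neq0 ?sqrrN ?expr1n.
Qed.

End ChebyshevQuotients.

(** * Half angles and solving for rho *)

Lemma sin_ratio_eq {F : fieldType} (y z c : F) :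
  y != 0 -> z != 0 -> z ^+ 2 != 1 ->
  (y - y^-1) / (z - z^-1) = c <-> (y ^+ 2 - 1) * z = c * (y * (z ^+ 2 - 1)).
Proof.
move=> y0 z0 z2.
have w0 : z - z^-1 != 0.
  by rewrite -(inj_eq (mulIf z0)) mulrBl mulVf // mul0r subr_eq0.
have E : (y ^+ 2 - 1) * z = (y - y^-1) / (z - z^-1) * (y * (z ^+ 2 - 1)).
  by field; rewrite z0 y0 subr_eq0 -expr2 z2.
split=> [<- //|]; rewrite E; apply: mulIf.
by rewrite mulf_neq0 // subr_eq0.
Qed.

(** Both cosines share the factor [w ^- m.+3 / 2]. The quotient depends on [w ^+ 2] alone, so the
    sign of [w], a choice hidden in Arccos, is immaterial. *)
Lemma chebT_half_ratio {C : numFieldType} (m : nat) (w : C) :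
  w != 0 -> let z := w ^+ 2 in
  chebT_half m.+3 w / chebT_half m.+1 w = (z ^+ m.+2 * z + 1) / (z ^+ m.+2 + z).
Proof.
move=> w0 z; have wm0 : w ^+ m.+3 != 0 by rewrite expf_neq0.
have c0 : w ^- m.+3 / 2%:R != 0 by rewrite mulf_neq0 ?invr_eq0 // pnatr_eq0.
have -> : chebT_half m.+3 w = w ^- m.+3 / 2%:R * (z ^+ m.+2 * z + 1).
  rewrite /chebT_half /z -exprSr -exprM mulnC muln2 -addnn exprD.
  by field.
have -> : chebT_half m.+1 w = w ^- m.+3 / 2%:R * (z ^+ m.+2 + z).
  have -> : z ^+ m.+2 + z = w ^+ 2 * (w ^+ m.+1 * w ^+ m.+1 + 1).
    by rewrite /z exprAC expr2 !exprS; ring.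
  rewrite /chebT_half -[m.+3]addn2 addnC exprD.
  by field; rewrite ?w0 ?expf_neq0.
by rewrite -mulf_div mulfV // mul1r.
Qed.

(** For z = e^(i mu) one has t = cos mu, and t^2 - 1 = ((z - 1/z)/2)^2 vanishes only at z = 1 or
    -1. *)
Lemma chebU_half {C : numFieldType} (k : nat) (w : C) :
  w != 0 -> let z := w ^+ 2 in let t := cos_of_half w in
  (t ^+ 2 != 1) = (z ^+ 2 != 1)
  /\ (z ^+ 2 != 1 -> (chebU k).[t] = (z ^+ k.+1 - z ^- k.+1) / (z - z^-1)).
Proof.
move=> w0 z t; have z0 : z != 0 by rewrite expf_neq0.
have two0 : 2%:R != 0 :> C by rewrite pnatr_eq0.
split=> [|z2].
  rewrite -subr_eq0 -[in RHS]subr_eq0.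
  have -> : t ^+ 2 - 1 = ((z ^+ 2 - 1) / (2%:R * z)) ^+ 2 by rewrite /t /cos_of_half -/z; field.
  by rewrite expf_eq0 /= mulf_eq0 invr_eq0 mulf_eq0 (negPf two0) (negPf z0) !orbF.
rewrite -(@chebU_joukowski _ _ z t) // mulfK //.
by rewrite -(inj_eq (mulIf z0)) mulrBl mulVf // mul0r subr_eq0.
Qed.

(** With [y] standing for z^n, the equation is linear in [rho] and gives (yz - 1)/(y - z), a
    quotient of sines. [Ey], which says sin(n mu) = n sin mu, turns it into xi times a quotient of
    cosines. *)
Lemma rho_type1 {C : numFieldType} (m : nat) (rho y z : C) :
  let N : C := m.+2%:R in z != 0 -> z ^+ 2 != 1 ->
  (y ^+ 2 - 1) * z = N * (y * (z ^+ 2 - 1)) ->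
  y * z - rho * y + rho * z - 1 = 0 <-> rho = xi m.+2 * ((y * z + 1) / (y + z)).
Proof.
move=> N z0 z2 Ey.
have N1 : N - 1 != 0 by rewrite /N -natr1 addrK pnatr_eq0.
have N2 : N + 1 != 0 by rewrite /N natr1 pnatr_eq0.
have z20 : z ^+ 2 - 1 != 0 by rewrite subr_eq0.
have two0 : 2%:R != 0 :> C by rewrite pnatr_eq0.
(* With A = (n+1)mu/2 and B = (n-1)mu/2, the equation sin(A+B) = n sin(A-B)
   reads (n-1) sin A cos B = (n+1) cos A sin B. *)
have I : (N - 1) * (y * z - 1) * (y + z) = (N + 1) * (y * z + 1) * (y - z).
  apply/eqP; rewrite -subr_eq0.
  rewrite -(mulr0 (- 2%:R)) -(subrr ((y ^+ 2 - 1) * z)) {2}Ey; apply/eqP; ring.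
(* If y = -z or y = z, then [I] makes 2 (N+1) z (z^2 - 1), respectively 2 (N-1) z (z^2 - 1),
   vanish. *)
have yDz : y + z != 0.
  apply/eqP=> /eqP; rewrite addr_eq0 => /eqP yz; move/eqP: I.
  rewrite yz addNr mulr0 eq_sym => /eqP h.
  have /eqP : (N + 1) * (2%:R * (z * (z ^+ 2 - 1))) = 0 by rewrite -[RHS]h; ring.
  by rewrite !mulf_eq0 (negPf N2) (negPf two0) (negPf z0) (negPf z20).
have yBz : y - z != 0.
  apply/eqP=> /eqP; rewrite subr_eq0 => /eqP yz; move/eqP: I.
  rewrite yz subrr mulr0 => /eqP h.
  have /eqP : (N - 1) * (2%:R * (z * (z ^+ 2 - 1))) = 0 by rewrite -[RHS]h; ring.
  by rewrite !mulf_eq0 (negPf N1) (negPf two0) (negPf z0) (negPf z20).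
have xiE : xi m.+2 = (N + 1) / (N - 1).
  have -> : N - 1 = m.+1%:R by rewrite /N -natr1 addrK.
  by rewrite /N natr1.
have -> : xi m.+2 * ((y * z + 1) / (y + z)) = (y * z - 1) / (y - z).
  rewrite xiE mulf_div; apply/eqP; rewrite eqr_div ?mulf_neq0 //; apply/eqP.
  by rewrite -I; ring.
split=> [h|->]; last by field.
apply: (mulIf yBz); rewrite divfK //; apply/eqP; rewrite -subr_eq0 -oppr_eq0 -[X in _ == X]h.
by apply/eqP; ring.
Qed.

(** The linear equation gives the quotient of cosines directly; [Ey] ensures that its denominator is
    nonzero. *)
Lemma rho_type2 {C : numFieldType} (m : nat) (rho y z : C) :
  let N : C := m.+2%:R in z != 0 -> z ^+ 2 != 1 ->
  (y ^+ 2 - 1) * z = - N * (y * (z ^+ 2 - 1)) ->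
  y * z - rho * y - rho * z + 1 = 0 <-> rho = (y * z + 1) / (y + z).
Proof.
move=> N z0 z2 Ey.
have N1 : N - 1 != 0 by rewrite /N -natr1 addrK pnatr_eq0.
have z20 : z ^+ 2 - 1 != 0 by rewrite subr_eq0.
have yDz : y + z != 0.
  apply/eqP=> /eqP; rewrite addr_eq0 => /eqP yz.
  have /eqP : (N - 1) * (z * (z ^+ 2 - 1)) = 0.
    by rewrite -(subrr ((y ^+ 2 - 1) * z)) {1}Ey yz; ring.
  by rewrite !mulf_eq0 (negPf N1) (negPf z0) (negPf z20).
split=> [h|->]; last by field.
apply: (mulIf yDz); rewrite divfK //; apply/eqP; rewrite -subr_eq0 -oppr_eq0 -[X in _ == X]h.
by apply/eqP; ring.
Qed.

(** * The two parametrizations of rho *)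

Lemma eigmult_type1 {C : numClosedFieldType} (m : nat) (rho : C) :
  rho != 0 -> rho ^+ 2 != 1 ->
  (eigmult m.+2 rho (- m.+2%:R) = 2%N /\ type1_eig m.+2 rho (- m.+2%:R)) <->
  exists t0 w : C, [/\ root (q1 m.+2) t0, w != 0, t0 = cos_of_half w &
    rho = xi m.+2 * (chebT_half m.+3 w / chebT_half m.+1 w)].
Proof.
move=> rho0 rho2; split.
- case=> _ [z [z0 z1 zN1 sz /oppr_inj lamE]].
  have z2 := sqr_neq1 _ z1 zN1.
  (* A square root of z = e^(i mu) supplies the half angle, and t0 is cos mu. *)
  have wz := sqrtCK z; set w := sqrtC z in wz.
  have w0 : w != 0 by rewrite sqrtC_eq0.
  have [t2 Ut] := chebU_half m.+1 _ w0; rewrite wz in t2 Ut.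
  exists (cos_of_half w), w; split=> //.
    by apply/root_q1; rewrite t2 Ut // lamE.
  rewrite chebT_half_ratio // wz; apply/(rho_type1 m) => //.
    by apply/sin_ratio_eq; rewrite ?expf_neq0.
  by rewrite -exprSr.
case=> t0 [w [/root_q1 [t2 Ut] w0 tE rhoE]].
have [t2E UtE] := chebU_half m.+1 _ w0.
rewrite tE t2E in t2; rewrite tE UtE // in Ut.
rewrite chebT_half_ratio // in rhoE.
have z0 : w ^+ 2 != 0 by rewrite expf_neq0.
move: (w ^+ 2) => z in t2 Ut rhoE z0 *.
have sz : z ^+ m.+2 * z - rho * z ^+ m.+2 + rho * z - 1 = 0.
  by apply/(rho_type1 m) => //; apply/sin_ratio_eq; rewrite ?expf_neq0.
split; last first.
  move: (t2); rewrite sqrf_eq1 negb_or => /andP [z1 zN1].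
  by exists z; rewrite exprSr Ut.
apply: (eigmult_type _ 1 _ z) => //; rewrite ?expr1n ?Ut ?mulN1r //.
by rewrite horner_symbol_poly -[RHS]sz; ring.
Qed.

Lemma eigmult_type2 {C : numClosedFieldType} (m : nat) (rho : C) :
  rho != 0 -> rho ^+ 2 != 1 ->
  (eigmult m.+2 rho (- m.+2%:R) = 2%N /\ type2_eig m.+2 rho (- m.+2%:R)) <->
  exists t0 w : C, [/\ root (q2 m.+2) t0, w != 0, t0 = cos_of_half w &
    rho = chebT_half m.+3 w / chebT_half m.+1 w].
Proof.
move=> rho0 rho2; split.
- case=> _ [z [z0 z1 zN1 sz lamE]].
  have z2 := sqr_neq1 _ z1 zN1.
  have wz := sqrtCK z; set w := sqrtC z in wz.
  have w0 : w != 0 by rewrite sqrtC_eq0.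
  have [t2 Ut] := chebU_half m.+1 _ w0; rewrite wz in t2 Ut.
  exists (cos_of_half w), w; split=> //.
    by apply/root_q2; rewrite t2 Ut // lamE.
  rewrite chebT_half_ratio // wz; apply/(rho_type2 m) => //.
    by apply/sin_ratio_eq; rewrite ?expf_neq0.
  by rewrite -exprSr.
case=> t0 [w [/root_q2 [t2 Ut] w0 tE rhoE]].
have [t2E UtE] := chebU_half m.+1 _ w0.
rewrite tE t2E in t2; rewrite tE UtE // in Ut.
rewrite chebT_half_ratio // in rhoE.
have z0 : w ^+ 2 != 0 by rewrite expf_neq0.
move: (w ^+ 2) => z in t2 Ut rhoE z0 *.
have sz : z ^+ m.+2 * z - rho * z ^+ m.+2 - rho * z + 1 = 0.
  by apply/(rho_type2 m) => //; apply/sin_ratio_eq; rewrite ?expf_neq0.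
split; last first.
  move: (t2); rewrite sqrf_eq1 negb_or => /andP [z1 zN1].
  by exists z; rewrite exprSr Ut.
(* The sign -1 selects c, for which the eigenvalue is the sine quotient itself. *)
apply: (eigmult_type _ (-1) _ z) => //; rewrite ?sqrrN ?expr1n ?Ut ?opprK ?mul1r //.
by rewrite horner_symbol_poly -[RHS]sz; ring.
Qed.

Theorem theorem4p5 (R : realType) (n : nat) (rho : R[i]) :
  (2 <= n)%N -> rho != -1 -> rho != 0 -> rho != 1 ->
  [/\ (forall lam : R[i], (1 < eigmult n rho lam)%N ->
          lam = - (n%:R) /\ eigmult n rho lam = 2%N),
      (eigmult n rho (- (n%:R)) = 2%N /\ type1_eig n rho (- (n%:R)) <->
        exists t0 w : R[i], [/\ root (q1 n) t0, w != 0, t0 = cos_of_half w &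
          rho = (xi n : R[i]) * (chebT_half n.+1 w / chebT_half n.-1 w)]) &
      (eigmult n rho (- (n%:R)) = 2%N /\ type2_eig n rho (- (n%:R)) <->
        exists t0 w : R[i], [/\ root (q2 n) t0, w != 0, t0 = cos_of_half w &
          rho = chebT_half n.+1 w / chebT_half n.-1 w])].
Proof.
case: n => [|[|m]] // _ rhoN1 rho0 rho1; have rho2 := sqr_neq1 _ rho1 rhoN1.
split; first by move=> lam; apply: eigmult_gt1.
  exact: eigmult_type1.
exact: eigmult_type2.
Qed.
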